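(* For all $j\geq 0$ and $n\geq 0$: $d_{9j+2}(9n+5)\equiv 0\pmod 9$ and $d_{9j+2}(9n+8)\equiv 0\pmod 9$.
   Context: For each integer $k\geq 1$, the numbers $d_k(n)$ are defined by $\sum_{n\geq 0} d_k(n)q^n = \frac{f_2^k}{f_1^{3k+1}}$, where $f_r = \prod_{i\geq 1}(1-q^{ri})$. *)

(* Defs.v *)
From mathcomp Require Import all_boot all_order all_algebra.
Set Implicit Arguments. Unset Strict Implicit. Unset Printing Implicit Defensive.
Import GRing.Theory Num.Theory.
Local Open Scope ring_scope.

Definition series := nat -> int.

Definition sone : series := fun n => if n is 0%N then 1 else 0.

Definition smul (a b : series) : series :=
  fun n => \sum_(i < n.+1) a i * b (n - i)%N.

Definition spow (a : series) (k : nat) : series := iter k (smul a) sone.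

(* The first n+1 coefficients of the multiplicative inverse of a series a
   with constant term a 0 = 1, via the recursion
   b 0 = 1,  b n = - \sum_(1 <= i <= n) a i * b (n - i). *)
Fixpoint sinv_list (a : series) (n : nat) : seq int :=
  match n with
  | 0%N => [:: 1]
  | m.+1 => let l := sinv_list a m in
            rcons l (- \sum_(1 <= i < m.+2) a i * nth 0 l (m.+1 - i)%N)
  end.

Definition sinv (a : series) : series := fun n => nth 0 (sinv_list a n) n.

(* f_r = prod_{i>=1} (1 - q^{r i}); its q^n coefficient equals that of the
   finite product over 1 <= i <= n (the remaining factors are 1 mod q^{n+1}). *)
Definition f (r : nat) : series :=
  fun n => (\prod_(1 <= i < n.+1) (1 - 'X^(r * i)%N) : {poly int})`_n.

Definition d (k : nat) : series :=
  smul (spow (f 2) k) (sinv (spow (f 1) (3 * k + 1))).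

(* Main.v *)
(* Since f_1^3 = f_3 mod 3, the ninth power of any f_r is a series in q^3 mod 9 and
   in q^9 mod 3.  From d_{9j+2} (f_1^9)^(3j+1) = (f_2^9)^j f_1^2 f_2^2 the claim
   reduces to f_1^2 f_2^2: its coefficients at 3n+2 vanish mod 3, and those at 9n+5
   and 9n+8 vanish mod 9.  Gauss's f_1^2/f_2 = sum_a (-1)^a q^(a^2) and Jacobi's
   f_2^3 = sum_l (-1)^l (2l+1) q^(l(l+1)) write f_1^2 f_2^2 as a double sum with
   weight 2l+1 at N = a^2 + l(l+1), where 4N+1 = (2a)^2 + (2l+1)^2.  If N = 2 mod 3,
   then 3 divides a and 2l+1, hence 9 divides 4N+1, which excludes N = 5, 8 mod 9.
   Both theta identities are limits of finite ones given by the q-binomial theorem;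
   they are used here only up to a truncation order. *)
Require Import Defs.
From mathcomp Require Import all_boot all_order all_algebra.
From mathcomp Require Import zify ring.
Set Implicit Arguments. Unset Strict Implicit. Unset Printing Implicit Defensive.
Import GRing.Theory Num.Theory.
Local Open Scope ring_scope.

(** * Gaussian binomials and the q-binomial theorem *)

Section QBinomial.
Variables (R : comNzRingType) (q : R).

Fixpoint qbin (m k : nat) : R :=
  match m, k with
  | _, 0 => 1
  | 0, _.+1 => 0
  | m'.+1, k'.+1 => qbin m' k' + q ^+ k * qbin m' k
  end.

Lemma qbinS m k : qbin m.+1 k.+1 = qbin m k + q ^+ k.+1 * qbin m k.+1.
Proof. by []. Qed.

Lemma qbin0 m : qbin m 0 = 1. Proof. by case: m. Qed.

Lemma qbin_small m k : (m < k)%N -> qbin m k = 0.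
Proof.
elim: m k => [|m IH] [|k] // lt_mk.
by rewrite qbinS !IH ?mulr0 ?addr0 //; lia.
Qed.

Definition qpoch (n : nat) : R := \prod_(i < n) (1 - q ^+ i.+1).

(** Division-free quotient formula. For [k > m] both sides vanish, the factor [i = m] being
    [1 - q ^+ 0]. *)
Lemma qpoch_qbin m k :
  qpoch k * qbin m k = \prod_(i < k) (1 - q ^+ (m - i)).
Proof.
elim: m k => [|m IH] [|k].
- by rewrite /qpoch !big_ord0 mul1r.
- by rewrite mulr0 big_ord_recl subnn expr0 subrr mul0r.
- by rewrite /qpoch !big_ord0 mul1r.
rewrite qbinS mulrDr mulrCA IH /qpoch big_ord_recr /= -/(qpoch k).
rewrite mulrAC IH [in RHS]big_ord_recl big_ord_recr /= subn0.
under [in RHS]eq_bigr => i _ do rewrite /bump leq0n add1n subSS.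
case: (leqP k m) => [le_km|lt_mk].
  have -> : q ^+ m.+1 = q ^+ k.+1 * q ^+ (m - k) by rewrite -exprD; congr (_ ^+ _); lia.
  by ring.
suff -> : \prod_(i < k) (1 - q ^+ (m - i)) = 0 by ring.
by rewrite (bigD1 (Ordinal lt_mk)) //= subnn expr0 subrr mul0r.
Qed.

(** Induction on [m]: splitting off the factor [i = 0] leaves the same product with [b * q] for [b],
    and q-Pascal recombines the two sums. *)
Lemma qbinomial_theorem m (a b : R) :
  \prod_(i < m) (a - b * q ^+ i) =
  \sum_(k < m.+1) (-1) ^+ k * q ^+ 'C(k, 2) * qbin m k * a ^+ (m - k) * b ^+ k.
Proof.
elim: m b => [|m IH] b; first by rewrite big_ord0 big_ord1 /= !mulr1.
rewrite big_ord_recl expr0 mulr1.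
under eq_bigr => i _ do rewrite lift0 exprS mulrA.
rewrite IH mulrBl !mulr_sumr [in RHS]big_ord_recl.
under [in RHS]eq_bigr => i _ do rewrite lift0 qbinS mulrDr !mulrDl.
rewrite big_split /= addrCA addrC; congr (_ + _); last first.
  rewrite -sumrN; apply: eq_bigr => i _; rewrite binS bin1 subSS exprD.
  by rewrite exprMn !exprS; ring.
rewrite big_ord_recl [in RHS]big_ord_recr /= (qbin_small (ltnSn m)) !mulr0 !mul0r addr0.
rewrite !qbin0 !subn0 exprS; congr (_ + _); first by rewrite !expr0; ring.
apply: eq_bigr => i _; rewrite /bump leq0n add1n subSS binS bin1.
have -> : (m - i = (m - i.+1).+1)%N by have := ltn_ord i; lia.
by rewrite exprMn !exprD !exprS; ring.
Qed.

End QBinomial.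

Lemma qbin_rmorph (R S : comNzRingType) (h : {rmorphism R -> S}) (q : R) m k :
  h (qbin q m k) = qbin (h q) m k.
Proof.
elim: m k => [|m IH] [|k] //=; rewrite ?rmorph1 ?rmorph0 //.
by rewrite rmorphD rmorphM rmorphXn !IH.
Qed.

Lemma bin2_double k : ('C(k, 2) * 2 + k = k * k)%N.
Proof. by elim: k => // k IH; rewrite binS bin1; nia. Qed.

Lemma prod_exp_ord (R : comNzRingType) (q : R) n :
  \prod_(i < n) q ^+ i = q ^+ 'C(n, 2).
Proof.
elim: n => [|n IH]; first by rewrite big_ord0.
by rewrite big_ord_recr /= IH binS bin1 exprD mulrC.
Qed.

Lemma prod_ord_rev (R : comNzRingType) n (F : nat -> R) :
  \prod_(i < n) F (n - i)%N = \prod_(i < n) F i.+1.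
Proof.
rewrite (reindex_inj rev_ord_inj); apply: eq_bigr => i _ /=.
by congr F; have := ltn_ord i; lia.
Qed.

(** * Finite Jacobi identity by differentiation at a simple root *)

Section FiniteTheta.
Variable R : comNzRingType.

Lemma qbinomial_poly (q : R) m :
  \prod_(i < m) ('X - (q ^+ i)%:P) =
  \sum_(k < m.+1) ((-1) ^+ k * q ^+ 'C(k, 2) * qbin q m k) *: 'X^(m - k).
Proof.
transitivity (\prod_(i < m) ('X - 1 * q%:P ^+ i) : {poly R}).
  by apply: eq_bigr => i _; rewrite mul1r polyC_exp.
rewrite qbinomial_theorem; apply: eq_bigr => k _.
rewrite expr1n mulr1 -qbin_rmorph -mul_polyC; congr (_ * _).
by rewrite !polyCM !polyC_exp polyCN.
Qed.

(* The root [q ^+ n] of [prod_(i < 2n+1) ('X - q ^+ i)] is simple; apply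
   [2 'X d/d'X - (2n+1)] to the q-binomial expansion and evaluate there.  Doubling
   and subtracting the (zero) value turns the weight [2n+1-k] into [2(n-k)+1]. *)
Lemma finite_jacobi (q : R) n :
  (q ^+ n * (\prod_(i < n) (q ^+ n - q ^+ i) *
             \prod_(i < n) (q ^+ n - q ^+ (n + i.+1)))) *+ 2 =
  \sum_(k < n.*2.+2) ((n.*2.+1 - k).*2%:R - n.*2.+1%:R) *
    ((-1) ^+ k * q ^+ 'C(k, 2) * qbin q n.*2.+1 k * q ^+ (n * (n.*2.+1 - k))).
Proof.
set m := n.*2.+1; set x := q ^+ n.
pose W : {poly R} := \prod_(i < n) ('X - (q ^+ i)%:P) *
                     \prod_(i < n) ('X - (q ^+ (n + i.+1))%:P).
have defP : \prod_(i < m) ('X - (q ^+ i)%:P) = ('X - x%:P) * W.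
  rewrite -(big_mkord xpredT (fun i => 'X - (q ^+ i)%:P)).
  rewrite (@big_cat_nat _ _ _ n) //=; last by rewrite /m; lia.
  rewrite (@big_ltn _ _ _ n m); last by rewrite /m; lia.
  rewrite big_mkord mulrCA; congr (_ * (_ * _)).
  rewrite -{1}[n.+1]add0n big_addn big_mkord.
  have -> : (m - n.+1 = n)%N by rewrite /m; lia.
  by apply: eq_bigr => i _; congr ('X - (_ ^+ _)%:P); lia.
have evW : W.[x] = \prod_(i < n) (x - q ^+ i) *
                   \prod_(i < n) (x - q ^+ (n + i.+1)).
  rewrite hornerM !horner_prod.
  by congr (_ * _); apply: eq_bigr => i _; rewrite hornerXsubC.
move: W defP evW => W defP evW.
(* Since P = (X - x) W, P vanishes at x and its derivative there is W(x). *)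
have := congr1 (fun p => (x * p^`().[x]) *+ 2 - p.[x] *+ m) defP.
rewrite derivM derivB derivX derivC subr0 mul1r.
rewrite ![(_ + _).[x]]hornerD ![(_ * _).[x]]hornerM hornerXsubC
  subrr !mul0r mul0rn subr0 addr0.
rewrite evW => <-.
rewrite qbinomial_poly raddf_sum !horner_sum mulr_sumr -!sumrMnl -sumrB.
apply: eq_bigr => k _; rewrite [X in _ * X.[_]]derivZ derivXn !hornerZ hornerMn !hornerXn.
set c := _ * qbin _ _ _.
rewrite /x -!exprM -/m.
rewrite -[_ *+ m]mulr_natr -muln2 natrM.
case: (m - k)%N => [|t] /=; first by rewrite muln0 expr0; ring.
by rewrite mulnS exprD -[_ *+ t.+1]mulr_natr; ring.
Qed.

End FiniteTheta.

(** * Finite forms of the Gauss and Jacobi theta identities *)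

Section TruncatedTheta.
Local Notation P := {poly int}.
Local Notation Q := ('X^2 : P).

Definition odd_prod (n : nat) : P := \prod_(i < n) (1 - 'X^(i.*2.+1)).

(* [(k - p) + (p - k)] is [|k - p|], the subtractions being truncated. *)
Lemma gauss_sum p : (0 < p)%N ->
  (-1) ^+ p * odd_prod p ^+ 2 =
  \sum_(k < p.*2.+1) (-1) ^+ k * 'X^(((k - p) + (p - k)) ^ 2) * qbin Q p.*2 k.
Proof.
(* With a = X^(2p-1) and b = 1, the factors [i < p] and those [i >= p] each give [odd_prod p] up to
   sign and a power of X; these powers combine to X^e. *)
move=> p_gt0; have := qbinomial_theorem Q p.*2 'X^(p.*2.-1) 1.
set e := (p * p + p * p.*2.-1 - p)%N.
have -> : \prod_(i < p.*2) ('X^(p.*2.-1) - 1 * Q ^+ i) =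
          'X^e * ((-1) ^+ p * odd_prod p ^+ 2).
  rewrite -addnn big_split_ord /= addnn.
  have -> : \prod_(i < p) ('X^(p.*2.-1) - 1 * Q ^+ i) =
            Q ^+ 'C(p, 2) * ((-1) ^+ p * odd_prod p).
    transitivity (\prod_(i < p) (Q ^+ i * (- (1 - 'X^((p - i).*2.-1))))).
      apply: eq_bigr => i _; rewrite -exprM mulrN mulrBr mulr1 -exprD opprB mul1r.
      by congr ('X^_ - _); have := ltn_ord i; lia.
    rewrite big_split /= prod_exp_ord; congr (_ * _).
    rewrite (prod_ord_rev _ (fun i => - (1 - 'X^(i.*2.-1)) : P)) prodrN card_ord.
    by [].
  have -> : \prod_(i < p) ('X^(p.*2.-1) - 1 * Q ^+ (p + i)) =
            'X^(p.*2.-1 * p) * odd_prod p.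
    transitivity (\prod_(i < p) ('X^(p.*2.-1) * (1 - 'X^(i.*2.+1)) : P)).
      apply: eq_bigr => i _; rewrite -exprM mulrBr mulr1 -exprD mul1r.
      by congr (_ - 'X^_); lia.
    by rewrite big_split /= prodr_const card_ord -exprM.
  have -> : 'X^e = Q ^+ 'C(p, 2) * 'X^(p.*2.-1 * p) :> P.
    by rewrite -exprM -exprD; congr 'X^_; have := bin2_double p; rewrite /e; lia.
  by ring.
move=> eqP; apply: (mulfI (x := 'X^e : P)); first by rewrite monic_neq0 ?monicXn.
rewrite eqP mulr_sumr; apply: eq_bigr => k _.
rewrite expr1n mulr1 mulrA mulrCA -!mulrA [qbin _ _ _ * _]mulrC !mulrA.
congr (_ * _); rewrite -!mulrA; congr (_ * _); rewrite -!exprM -!exprD; congr 'X^_.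
(* The exponents match because k(k-1) + (2p-1)(2p-k) = e + (k-p)^2. *)
have := ltn_ord k; have := bin2_double k; rewrite /e.
move: (nat_of_ord k) 'C(k, 2) => {}k c hc lt_k.
have [u_eq p_le] : (p.*2.-1 + 1 = p + p)%N /\ (p <= p * p)%N by split; nia.
move: (p.*2.-1) u_eq => u u_eq; rewrite -addnn in lt_k *.
have [le_kp|lt_pk] := leqP k p.
  have defp : p = (k + (p - k))%N by lia.
  move: (p - k)%N defp => t defp.
  have -> : (k - p = 0)%N by lia.
  have -> : (p + p - k = p + t)%N by lia.
  have : (u * t + t = (p + p) * t)%N by rewrite -u_eq mulnDl mul1n.
  by subst p; nia.
have defk : k = (p + (k - p))%N by lia.
have defp : p = ((k - p) + (p + p - k))%N by lia.
move: (k - p)%N (p + p - k)%N defk defp => t s defk defp.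
have -> : (p - k = 0)%N by lia.
have : (u * t + t = (p + p) * t)%N by rewrite -u_eq mulnDl mul1n.
by subst k p; nia.
Qed.

(* With [l = (k - n.+1) + (n - k)], the weight is [2l+1] if [k <= n] and [-(2l+1)]
   otherwise. *)
Lemma jacobi_sum n :
  ((-1) ^+ n * qpoch Q n ^+ 2) *+ 2 =
  \sum_(k < n.*2.+2) ((n.*2.+1 - k).*2%:R - n.*2.+1%:R) * (-1) ^+ k *
     'X^(((k - n.+1) + (n - k)) * ((k - n.+1) + (n - k)).+1) * qbin Q n.*2.+1 k.
Proof.
have := finite_jacobi Q n; set e := ('C(n, 2) + n + n * n).*2%N.
have -> : \prod_(i < n) (Q ^+ n - Q ^+ i) = Q ^+ 'C(n, 2) * ((-1) ^+ n * qpoch Q n).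
  transitivity (\prod_(i < n) (Q ^+ i * (- (1 - Q ^+ (n - i))))).
    apply: eq_bigr => i _; rewrite mulrN mulrBr mulr1 -exprD opprB.
    by rewrite subnKC // ltnW.
  rewrite big_split /= prod_exp_ord; congr (_ * _).
  by rewrite (prod_ord_rev _ (fun i => - (1 - Q ^+ i))) prodrN card_ord.
have -> : \prod_(i < n) (Q ^+ n - Q ^+ (n + i.+1)) = Q ^+ (n * n) * qpoch Q n.
  rewrite exprM -[X in _ ^+ X * _](card_ord n) -prodr_const -big_split /=.
  by apply: eq_bigr => i _; rewrite mulrBr mulr1 exprD.
move=> eqP; apply: (mulfI (x := 'X^e : P)); first by rewrite monic_neq0 ?monicXn.
transitivity (\sum_(k < n.*2.+2) ((n.*2.+1 - k).*2%:R - n.*2.+1%:R) *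
    ((-1) ^+ k * Q ^+ 'C(k, 2) * qbin Q n.*2.+1 k * Q ^+ (n * (n.*2.+1 - k)))).
  rewrite -eqP /e -mul2n exprM !exprD.
  by ring.
rewrite mulr_sumr; apply: eq_bigr => k _.
set c := _ - _; set b := qbin _ _ _; set r := (_ * _.+1)%N.
(* k(k-1) + 2n(2n+1-k) = e + l(l+1), both for l = n-k and for l = k-n-1. *)
suff eq_exp : Q ^+ 'C(k, 2) * Q ^+ (n * (n.*2.+1 - k)) = 'X^e * 'X^r.
  transitivity (c * (-1) ^+ k * b * (Q ^+ 'C(k, 2) * Q ^+ (n * (n.*2.+1 - k)))).
    by ring.
  by rewrite eq_exp; ring.
rewrite -!exprM -!exprD; congr 'X^_; rewrite /e /r.
have := ltn_ord k; have := bin2_double k; have := bin2_double n.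
move: (nat_of_ord k) 'C(k, 2) 'C(n, 2) => {e r c b eqP}k c b hb hc lt_k.
have [le_kn|lt_nk] := leqP k n.
  have defn : n = (k + (n - k))%N by lia.
  have -> : (k - n.+1 = 0)%N by lia.
  have -> : (n.*2.+1 - k = n.+1 + (n - k))%N by lia.
  by move: (n - k)%N defn => t defn; subst n; nia.
have defk : k = (n.+1 + (k - n.+1))%N by lia.
have defn : n = ((k - n.+1) + (n.*2.+1 - k))%N by lia.
have -> : (n - k = 0)%N by lia.
move: (k - n.+1)%N (n.*2.+1 - k)%N defk defn => t s defk defn.
by subst k n; nia.
Qed.

End TruncatedTheta.

(** * Congruence modulo X^N *)

Definition eqX (N : nat) (p q : {poly int}) := forall i, (i < N)%N -> p`_i = q`_i.

Lemma eqX_trans N p q r : eqX N p q -> eqX N q r -> eqX N p r.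
Proof. by move=> pq qr i lt_iN; rewrite pq ?qr. Qed.

Lemma eqX_mul N p p' q q' : eqX N p p' -> eqX N q q' -> eqX N (p * q) (p' * q').
Proof.
move=> pp' qq' i lt_iN; rewrite !coefM; apply: eq_bigr => j _.
by rewrite pp' ?qq' //; have := ltn_ord j; lia.
Qed.

Lemma eqX_exp N p p' k : eqX N p p' -> eqX N (p ^+ k) (p' ^+ k).
Proof.
by move=> pp'; elim: k => [|k IH] //; rewrite !exprS; apply: eqX_mul.
Qed.

Lemma eqX_sum N n (F G : 'I_n -> {poly int}) :
  (forall i, eqX N (F i) (G i)) -> eqX N (\sum_i F i) (\sum_i G i).
Proof.
by move=> FG i lt_iN; rewrite !coef_sum; apply: eq_bigr => k _; apply: FG.
Qed.

Lemma eqX_prod1 N n (F : 'I_n -> {poly int}) :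
  (forall i, eqX N (F i) 1) -> eqX N (\prod_i F i) 1.
Proof.
move=> F1; elim/big_ind: _ => // p q p1 q1.
by rewrite -[1]mulr1; apply: eqX_mul.
Qed.

Lemma eqX_1BXn N e : (N <= e)%N -> eqX N (1 - 'X^e) 1.
Proof.
by move=> le_Ne i lt_iN; rewrite coefB coefXn (ltn_eqF (leq_trans lt_iN le_Ne)) subr0.
Qed.

Lemma eqX_shift N e p q : eqX (N - e) p q -> eqX N ('X^e * p) ('X^e * q).
Proof.
move=> pq i lt_iN; rewrite !coefXnM; case: ltnP => // le_ei.
by apply: pq; lia.
Qed.

(** * Partial Euler products and the limits of the finite identities *)

Definition eta (r n : nat) : {poly int} := \prod_(i < n) (1 - 'X^(r * i.+1)).

Lemma eta0 r n : (0 < r)%N -> (eta r n)`_0 = 1.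
Proof.
move=> r_gt0; have eta1 : eqX 1 (eta r n) 1.
  by apply: eqX_prod1 => i; apply: eqX_1BXn; nia.
by rewrite (eta1 0) // coef1.
Qed.

Lemma eqX_eta r N m n : (0 < r)%N -> (N <= r * m.+1)%N -> (N <= r * n.+1)%N ->
  eqX N (eta r m) (eta r n).
Proof.
have le_case a b : (N <= r * a.+1)%N -> (a <= b)%N -> eqX N (eta r b) (eta r a).
  move=> le_N /subnKC <-; elim: (b - a)%N => [|t IH]; first by rewrite addn0.
  rewrite addnS -[eta r a]mulr1 [eta r _.+1]big_ord_recr /=.
  by apply: eqX_mul => //; apply: eqX_1BXn; nia.
move=> r_gt0 le_m le_n; case: (leqP m n) => [le_mn|/ltnW le_nm]; last exact: le_case.
by move=> i lt_i; rewrite (le_case m n).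
Qed.

Lemma qpoch_eta r n : qpoch ('X^r : {poly int}) n = eta r n.
Proof. by apply: eq_bigr => i _; rewrite exprM. Qed.

(** Odd and even factors separate exactly when their total number is even; hence [eta 1 p.*2] stands
    for f_1 below. *)
Lemma eta_double n : eta 1 n.*2 = odd_prod n * eta 2 n.
Proof.
elim: n => [|n IH]; first by rewrite /eta /odd_prod !big_ord0 mulr1.
rewrite /eta doubleS !big_ord_recr /= -/(eta _ _) IH /odd_prod big_ord_recr /=.
rewrite !mul1n (_ : (2 * n.+1)%N = n.*2.+2); last by lia.
by rewrite /eta; ring.
Qed.

(** The Gaussian binomial tends to 1/f_2. The error is of order about 2 min(k, m-k), so near the
    ends of the range the factor X^e must supply the missing order. *)
Lemma eqX_qbin N e m n k : (k <= m)%N -> (N <= e + k.+1.*2)%N ->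
  (N <= e + n.+1.*2)%N -> (N <= e + (m - k).+1.*2)%N ->
  eqX N ('X^e * qbin 'X^2 m k * eta 2 n) 'X^e.
Proof.
move=> le_km le_k le_n le_mk; rewrite -[X in eqX _ _ X]mulr1 -mulrA.
apply: eqX_shift; rewrite mulrC.
apply: (@eqX_trans _ _ (eta 2 k * qbin 'X^2 m k)).
  by apply: eqX_mul => //; apply: eqX_eta; lia.
rewrite -qpoch_eta qpoch_qbin; apply: eqX_prod1 => i.
by rewrite -exprM; apply: eqX_1BXn; have := ltn_ord i; lia.
Qed.

Lemma gauss_eqX p : (0 < p)%N ->
  eqX p ((-1) ^+ p * odd_prod p ^+ 2 * eta 2 p)
        (\sum_(k < p.*2.+1) (-1) ^+ k * 'X^(((k - p) + (p - k)) ^ 2)).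
Proof.
move=> p_gt0; rewrite gauss_sum // mulr_suml; apply: eqX_sum => k.
rewrite -!mulrA; apply: eqX_mul => //; rewrite mulrA.
by apply: eqX_qbin; have := ltn_ord k; nia.
Qed.

(** Twice Jacobi's series: each l occurs at k = n-l and at k = n+1+l, where both the weight and
    (-1)^k change sign, so the two terms agree. *)
Lemma jacobi_eqX n :
  eqX n (((-1) ^+ n * eta 2 n ^+ 2) *+ 2 * eta 2 n)
    (\sum_(k < n.*2.+2) ((n.*2.+1 - k).*2%:R - n.*2.+1%:R) * (-1) ^+ k *
     'X^(((k - n.+1) + (n - k)) * ((k - n.+1) + (n - k)).+1)).
Proof.
rewrite -{1}qpoch_eta jacobi_sum mulr_suml; apply: eqX_sum => k.
rewrite -!mulrA; apply: eqX_mul => //; apply: eqX_mul => //; rewrite mulrA.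
by apply: eqX_qbin; have := ltn_ord k; nia.
Qed.

(** * Divisibility by 3 and 9 along residue classes *)

(* Imposed on all coefficients [x] at [q^i], this says that the series lies in
   [Z[[q^9]] + 3 Z[[q^3]] + 9 Z[[q]]]. *)
Definition supp39 (i : nat) (x : int) :=
  (~~ (3 %| i)%N -> (9 %| x)%Z) /\ (~~ (9 %| i)%N -> (3 %| x)%Z).

(** The target condition mod 9; the condition mod 3 is carried along to make it stable under
    multiplication by [supp39] series. *)
Definition div39 (i : nat) (x : int) :=
  ((i %% 3 = 2)%N -> (3 %| x)%Z) /\
  ((i %% 9 = 5)%N \/ (i %% 9 = 8)%N -> (9 %| x)%Z).

Lemma dvd9_3 (x : int) : (9 %| x)%Z -> (3 %| x)%Z.
Proof. by apply: dvdz_trans. Qed.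

Lemma supp39_mul j k x y : supp39 j x -> supp39 k y -> supp39 (j + k) (x * y).
Proof.
move=> [x9 x3] [y9 y3]; split=> dvd_jk.
  case: (boolP (3 %| j)%N) => [dvd_j|/x9]; last exact: dvdz_mulr.
  by apply: dvdz_mull; apply: y9; rewrite -(dvdn_addr _ dvd_j).
case: (boolP (9 %| j)%N) => [dvd_j|/x3]; last exact: dvdz_mulr.
by apply: dvdz_mull; apply: y3; rewrite -(dvdn_addr _ dvd_j).
Qed.

(** If 9 divides j, then k has the residue of j + k mod 9; if only 3 does, then x and y each
    contribute a factor 3; otherwise 9 divides x. *)
Lemma div39_mul j k x y : supp39 j x -> div39 k y -> div39 (j + k) (x * y).
Proof.
move=> [x9 x3] [y3 y9].
have dvd3 : ((j + k) %% 3 = 2)%N -> (3 %| x * y)%Z.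
  move=> jk; case: (boolP (3 %| j)%N) => [dvd_j|/x9/dvd9_3]; last exact: dvdz_mulr.
  by apply: dvdz_mull; apply: y3; lia.
split=> // jk.
case: (boolP (9 %| j)%N) => [dvd_j|ndvd_j].
  by apply: dvdz_mull; apply: y9; lia.
case: (boolP (3 %| j)%N) => [dvd_j|/x9]; last exact: dvdz_mulr.
by rewrite (_ : 9 = 3 * 3) //; apply: dvdz_mul; [apply: x3 | apply: y3; lia].
Qed.

Lemma supp39_sum i n (F : 'I_n -> int) :
  (forall k, supp39 i (F k)) -> supp39 i (\sum_k F k).
Proof. by move=> F39; split=> ndvd; apply: rpred_sum => k _; case: (F39 k); auto. Qed.

Lemma div39_sum i n (F : 'I_n -> int) :
  (forall k, div39 i (F k)) -> div39 i (\sum_k F k).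
Proof. by move=> F39; split=> hi; apply: rpred_sum => k _; case: (F39 k); auto. Qed.

Lemma div39B i x y : div39 i x -> div39 i y -> div39 i (x - y).
Proof.
by move=> [x3 x9] [y3 y9]; split=> hi; apply: rpredB; auto.
Qed.

Definition suppX (w : {poly int}) := forall i, supp39 i w`_i.

Lemma suppX_1 : suppX 1.
Proof. by move=> [|i]; rewrite coef1. Qed.

Lemma suppX_mul v w : suppX v -> suppX w -> suppX (v * w).
Proof.
move=> v39 w39 i; rewrite coefM; apply: supp39_sum => k.
by rewrite -{1}(subnKC (ltn_ord k : k <= i)%N); apply: supp39_mul.
Qed.

Lemma suppX_exp w n : suppX w -> suppX (w ^+ n).
Proof.
move=> w39; elim: n => [|n IH]; first exact: suppX_1.
by rewrite exprS; apply: suppX_mul.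
Qed.

(** The binomial coefficient of 9 over k is divisible by 9 if 3 does not divide k, and by 3 if 0 < k
    < 9. *)
Lemma suppX_1BXn_9 e : suppX ((1 - 'X^e) ^+ 9).
Proof.
move=> i; rewrite exprBn coef_sum; apply: supp39_sum => k.
rewrite coefMn expr1n mulr1 -exprM.
have -> : (-1) ^+ k = ((-1) ^+ k)%:P :> {poly int} by rewrite polyC_exp polyCN.
rewrite coefCM coefXn.
case: eqP => [->|_]; last by rewrite mulr0 mul0rn.
rewrite mulr1 -mulr_natr natz; have lt_k := ltn_ord k.
by split=> ndvd; apply: dvdz_mull; move: (nat_of_ord k) lt_k ndvd => {}k;
  do 10?[case: k => [|k] //]; lia.
Qed.

Lemma suppX_eta9 r n : suppX (eta r n ^+ 9).
Proof.
rewrite /eta -prodrXl; elim/big_ind: _ => [|v w|i _].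
- exact: suppX_1.
- exact: suppX_mul.
- exact: suppX_1BXn_9.
Qed.

Definition divX N (p : {poly int}) := forall i, (i < N)%N -> div39 i p`_i.

Lemma divX_mul N w p : suppX w -> divX N p -> divX N (w * p).
Proof.
move=> w39 p39 i lt_iN; rewrite coefM; apply: div39_sum => k.
have le_ki : (k <= i)%N := ltn_ord k.
by rewrite -{1}(subnKC le_ki); apply: div39_mul => //; apply: p39; lia.
Qed.

(** Division by w: as its constant term is 1, each coefficient of p is that of w p minus products
    with earlier coefficients of p. *)
Lemma divX_mul_inv N w p : suppX w -> w`_0 = 1 -> divX N (w * p) -> divX N p.
Proof.
move=> w39 w0 wp39 i; elim/ltn_ind: i => i IH lt_iN.
have := wp39 i lt_iN; rewrite coefM big_ord_recl w0 mul1r subn0 => wp39_i.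
rewrite -[p`_i](addrK (\sum_(k < i) w`_(lift ord0 k) * p`_(i - lift ord0 k))).
apply: div39B => //; apply: div39_sum => k; have lt_ki := ltn_ord k.
rewrite lift0 -{1}(subnKC lt_ki).
by apply: div39_mul => //; apply: IH; lia.
Qed.

(** * The coefficients of f_1^2 f_2^2 *)

(* [4 (a^2 + l (l + 1)) + 1 = (2a)^2 + (2l+1)^2], and [-1] is not a square mod 3. *)
Lemma div39_theta a l c :
  ((2 * l + 1)%:Z %| c)%Z -> div39 (a ^ 2 + l * l.+1) c.
Proof.
move=> dvd_c.
have dvd3 : ((a ^ 2 + l * l.+1) %% 3 = 2)%N -> (3 %| a)%N && (3 %| 2 * l + 1)%N.
  have mod3 x : (x = 3 * (x %/ 3) \/ x = 3 * (x %/ 3) + 1 \/ x = 3 * (x %/ 3) + 2)%N.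
    by lia.
  move: (a %/ 3)%N (l %/ 3)%N (mod3 a) (mod3 l) => u v.
  by do 2![case=> [->|[->|->]]]; nia.
split=> [/dvd3/andP[_ dvd_l]|hi]; first by apply: dvdz_trans dvd_c.
have /dvd3/andP[/dvdnP[u defa] /dvdnP[v defl]] : ((a ^ 2 + l * l.+1) %% 3 = 2)%N by lia.
(* For N = 5 or 8 mod 9, 4N + 1 is 3 or 6 mod 9. *)
exfalso; have : (4 * (a ^ 2 + l * l.+1) + 1 = 9 * (4 * u ^ 2 + v ^ 2))%N by nia.
by move: (a ^ 2 + _)%N (_ + v ^ 2)%N hi; lia.
Qed.

Lemma divX_eta p : (0 < p)%N -> divX p (eta 1 p.*2 ^+ 2 * eta 2 p ^+ 2).
Proof.
move=> p_gt0; set Th := _ * _.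
(* The finite Jacobi sum yields twice f_2^3; 2 is invertible mod 9. *)
suff Th2 : divX p (Th *+ 2).
  move=> i /Th2; rewrite coefMn /div39 => -[h3 h9].
  by split=> [/h3|/h9]; lia.
have eqTh : Th *+ 2 = ((-1) ^+ p * odd_prod p ^+ 2 * eta 2 p) *
                      (((-1) ^+ p * eta 2 p ^+ 2) *+ 2 * eta 2 p).
  have sgn2 : (-1) ^+ p * (-1) ^+ p = 1 :> {poly int} by rewrite -exprMn mulrNN mulr1 expr1n.
  by move: ((-1) ^+ p) sgn2 => s s2; rewrite /Th eta_double -[LHS]mul1r -s2; ring.
move=> i lt_ip; rewrite eqTh (eqX_mul (gauss_eqX p_gt0) (@jacobi_eqX p)) //.
rewrite mulr_suml coef_sum; apply: div39_sum => k.
rewrite mulr_sumr coef_sum; apply: div39_sum => k'.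
set a := (_ - _ + _)%N; set l := (_ + _)%N.
pose c : int := (-1) ^+ k * (((p.*2.+1 - k').*2%:R - p.*2.+1%:R) * (-1) ^+ k').
have -> : (-1) ^+ k * 'X^(a ^ 2) * (((p.*2.+1 - k').*2%:R - p.*2.+1%:R) *
            (-1) ^+ k' * 'X^(l * l.+1)) = c%:P * 'X^(a ^ 2 + l * l.+1) :> {poly int}.
  rewrite exprD /c !polyCM polyCB !polyC_exp polyCN !polyC_natr; ring.
rewrite coefCM coefXn; case: eqP => [->|_]; last by rewrite mulr0.
rewrite mulr1; apply: div39_theta; apply: dvdz_mull; apply: dvdz_mulr.
rewrite !natz {c}/l {l}; have := ltn_ord k'; move: (nat_of_ord k') => {}k' lt_k'.
have [le_k|lt_k] := leqP k' p.
  by rewrite (_ : _ - _ = (2 * (k' - p.+1 + (p - k')) + 1)%N%:Z) ?dvdzz //; lia.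
by rewrite (_ : _ - _ = - (2 * (k' - p.+1 + (p - k')) + 1)%N%:Z) ?rpredN ?dvdzz //; lia.
Qed.

(** * From power series to polynomials, and the generating function of d *)

Definition trunc N (a : series) : {poly int} := \poly_(i < N) a i.

Lemma coef_trunc N a i : (i < N)%N -> (trunc N a)`_i = a i.
Proof. by move=> lt_iN; rewrite coef_poly lt_iN. Qed.

Lemma trunc_smul N a b : eqX N (trunc N (smul a b)) (trunc N a * trunc N b).
Proof.
move=> i lt_iN; rewrite coef_trunc // coefM; apply: eq_bigr => k _.
by rewrite !coef_trunc //; have := ltn_ord k; lia.
Qed.

Lemma trunc_sone N : eqX N (trunc N sone) 1.
Proof. by move=> [|i] lt_iN; rewrite coef_trunc // coef1. Qed.

Lemma trunc_spow N a k : eqX N (trunc N (spow a k)) (trunc N a ^+ k).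
Proof.
elim: k => [|k IH]; first exact: trunc_sone.
apply: eqX_trans (trunc_smul _ _) _.
by rewrite exprS; apply: eqX_mul.
Qed.

Lemma trunc_f N n r : (0 < r)%N -> (N <= n.+1)%N -> eqX N (trunc N (f r)) (eta r n).
Proof.
move=> r_gt0 le_Nn i lt_iN; rewrite coef_trunc // /f.
rewrite big_add1 big_mkord -/(eta r i).
by apply: (@eqX_eta r i.+1); nia.
Qed.

Lemma size_sinv_list a n : size (sinv_list a n) = n.+1.
Proof. by elim: n => //= n IH; rewrite size_rcons IH. Qed.

Lemma nth_sinv_list a n i : (i <= n)%N -> nth 0 (sinv_list a n) i = sinv a i.
Proof.
elim: n => [|n IH]; first by case: i.
rewrite leq_eqVlt => /predU1P[-> //|lt_in].
by rewrite /= nth_rcons size_sinv_list lt_in IH.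
Qed.

Lemma sinvS a n : sinv a n.+1 = - \sum_(i < n.+1) a i.+1 * sinv a (n - i)%N.
Proof.
rewrite {1}/sinv /= nth_rcons size_sinv_list ltnn eqxx big_add1 big_mkord.
by congr (- _); apply: eq_bigr => i _; rewrite subSS nth_sinv_list ?leq_subr.
Qed.

Lemma smul_sinv a n : a 0%N = 1 -> smul a (sinv a) n = sone n.
Proof.
move=> a0; case: n => [|n]; first by rewrite /smul big_ord1 a0 mul1r.
by rewrite /smul big_ord_recl a0 mul1r subn0 sinvS addNr.
Qed.

Lemma f0 r : f r 0 = 1.
Proof. by rewrite /f big_geq // coef1. Qed.

Lemma spow0 a k : a 0%N = 1 -> spow a k 0 = 1.
Proof.
by move=> a0; elim: k => //= k IH; rewrite /smul big_ord1 a0 mul1r.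
Qed.

Lemma trunc_d N k p : (N <= p)%N ->
  eqX N (eta 1 p.*2 ^+ (3 * k + 1) * trunc N (d k)) (eta 2 p ^+ k).
Proof.
move=> le_Np; set S := sinv (spow (f 1) (3 * k + 1)).
have truncS : eqX N (eta 1 p.*2 ^+ (3 * k + 1) * trunc N S) 1.
  apply: (@eqX_trans _ _ (trunc N (spow (f 1) (3 * k + 1)) * trunc N S)).
    apply: eqX_mul => //.
    have trunc_f1 : eqX N (trunc N (f 1)) (eta 1 p.*2) by apply: trunc_f; lia.
    by move=> i lt_iN; rewrite trunc_spow // (eqX_exp _ trunc_f1).
  move=> i lt_iN; rewrite -trunc_smul // coef_trunc // smul_sinv ?spow0 ?f0 //.
  by rewrite -(trunc_sone lt_iN) coef_trunc.
have truncP2 : eqX N (trunc N (spow (f 2) k)) (eta 2 p ^+ k).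
  apply: eqX_trans (trunc_spow _ _) _.
  by apply: eqX_exp; apply: trunc_f => //; lia.
apply: (@eqX_trans _ _ (eta 1 p.*2 ^+ (3 * k + 1) *
                        (trunc N (spow (f 2) k) * trunc N S))).
  by apply: eqX_mul => //; apply: trunc_smul.
rewrite mulrCA -[X in eqX _ _ X]mulr1; exact: eqX_mul.
Qed.

(** The factor f_1^(9(3j+1)) is cancelled by [divX_mul_inv]; 9(3j+1) exceeds the exponent 3(9j+2)+1
    of the denominator by 2, which leaves f_1^2. Order i+1 suffices to read off coefficient i. *)
Lemma div39_d j i : div39 i (d (9 * j + 2) i).
Proof.
set p := i.+1; rewrite -(@coef_trunc p) //.
apply: (@divX_mul_inv p ((eta 1 p.*2 ^+ 9) ^+ (3 * j + 1))) => //.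
- by apply/suppX_exp/suppX_eta9.
- rewrite -exprM; elim: (9 * _)%N => [|m IH]; first by rewrite coef1.
  by rewrite exprS coef0M eta0 ?mul1r.
set D := trunc _ _; move=> m lt_mp.
have lhsE : (eta 1 p.*2 ^+ 9) ^+ (3 * j + 1) =
            eta 1 p.*2 ^+ 2 * eta 1 p.*2 ^+ (3 * (9 * j + 2) + 1).
  by rewrite -exprM -exprD; congr (_ ^+ _); lia.
have rhsE : eta 1 p.*2 ^+ 2 * eta 2 p ^+ (9 * j + 2) =
            (eta 2 p ^+ 9) ^+ j * (eta 1 p.*2 ^+ 2 * eta 2 p ^+ 2).
  by rewrite -exprM exprD; ring.
have eqD : eqX p (eta 1 p.*2 ^+ (3 * (9 * j + 2) + 1) * D) (eta 2 p ^+ (9 * j + 2)).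
  exact: trunc_d.
rewrite lhsE -mulrA (eqX_mul (fun _ _ => erefl) eqD) // rhsE.
by apply: divX_mul lt_mp; [apply/suppX_exp/suppX_eta9 | apply: divX_eta].
Qed.

Theorem theorem4p6 (j n : nat) :
  (d (9 * j + 2) (9 * n + 5) = 0 %[mod 9])%Z /\
  (d (9 * j + 2) (9 * n + 8) = 0 %[mod 9])%Z.
Proof.
have [_ dvd5] := div39_d j (9 * n + 5); have [_ dvd8] := div39_d j (9 * n + 8).
split; rewrite mod0z; apply/dvdz_mod0P; [apply: dvd5 | apply: dvd8]; lia.
Qed.
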